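(* For all $n$ and $p\in[1,n^{2-o(1)}]$, $$\mathtt{DSFG}(n,p)=\Omega\left(\frac{\beta(n,p,\infty)}{n^{3/2}}\right).$$ In particular, $\mathtt{DSFG}(n,n^{2-o(1)})=\Omega(n^{1/2-o(1)})$.
   Context: Directed Steiner Forest: given a directed graph $G=(V,E,w)$ with nonnegative edge weights and demand pairs $P\subseteq V\times V$, $\textsc{DSF}(G,P)$ is the minimum total weight $\sum_{e}w_e x_e$ over $x\in\{0,1\}^E$ such that, for every $(s,t)\in P$, the edge capacities $\{x_e\}$ support a one-unit $s$-$t$ flow in $G$ (equivalently, the chosen edges contain an $s\leadsto t$ path for every $(s,t)\in P$). Its flow LP relaxation $\widehat{\textsc{DSF}}(G,P)$ is the same minimum with $x_e\ge 0$ real, still requiring that for each $(s,t)\in P$ separately the capacities $\{x_e\}$ support a one-unit $s$-$t$ flow. $\mathtt{DSFG}(n,p)$ is the least integer $k$ such that for every $n$-node weighted directed graph $G$ and set $P$ of $|P|=p$ demand pairs, $\textsc{DSF}(G,P)\le k\cdot\widehat{\textsc{DSF}}(G,P)$. A path system is $S=(V,\Pi)$ with $V$ a finite set of nodes and $\Pi$ a multiset of node sequences (paths), each containing each node at most once; size $\|S\|=\sum_\pi|\pi|$ ($|\pi|$ = number of nodes). Write $x<_\pi y$ if $x$ strictly precedes $y$ in $\pi$. A $b$-bridge: $b$ distinct nodes $v_1,\dots,v_b$ and $b$ distinct paths $\pi_1,\dots,\pi_b$ with $v_i<_{\pi_i}v_{i+1}$ ($1\le i\le b-1$) and $v_1<_{\pi_b}v_b$.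 Bridge girth = least $b$ admitting a $b$-bridge ($\infty$ if none). $\beta(n,p,k)$ = maximum size of a path system with $n$ nodes, $p$ paths and bridge girth $>k$. *)

(* Defs.v *)
From HB Require Import structures.
From mathcomp Require Import all_boot all_order all_algebra.
From mathcomp Require Import all_classical all_reals all_analysis.
Set Implicit Arguments. Unset Strict Implicit. Unset Printing Implicit Defensive.
Import Order.TTheory GRing.Theory Num.Theory.
Local Open Scope ring_scope.

Section DSF.
Variable R : realType.

(* A weighted directed graph on the node set 'I_n is given by an edge
   relation E and weights w (only the values on edges matter). *)

Definition supports_flow (n : nat) (E : rel 'I_n) (x : 'I_n -> 'I_n -> R)
    (s t : 'I_n) : Prop :=
  exists f : 'I_n -> 'I_n -> R,
    (forall u v, 0 <= f u v /\ f u v <= x u v) /\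
    (forall u v, ~~ E u v -> f u v = 0) /\
    (forall v, \sum_(u < n) f v u - \sum_(u < n) f u v
               = (v == s)%:R - (v == t)%:R).

Definition cost (n : nat) (E : rel 'I_n) (w x : 'I_n -> 'I_n -> R) : R :=
  \sum_(u < n) \sum_(v < n | E u v) w u v * x u v.

(* Integral solutions are edge subsets y, i.e. x_e = y_e in {0,1}. *)
Definition ind (n : nat) (y : rel 'I_n) : 'I_n -> 'I_n -> R :=
  fun u v => (y u v)%:R.

(* DSF(G,P) <= k * LPDSF(G,P) for every n-node weighted digraph and every set
   P of p demand pairs.  Since DSF and LPDSF are minima, this is spelled out as:
   every feasible fractional solution x admits a feasible integral solution y
   of cost at most k times the cost of x. *)
Definition DSFG_ok (n p k : nat) : Prop :=
  forall (E : rel 'I_n) (w : 'I_n -> 'I_n -> R) (P : {set 'I_n * 'I_n}),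
    (forall u v, E u v -> 0 <= w u v) ->
    #|P| = p ->
    forall x : 'I_n -> 'I_n -> R,
      (forall u v, 0 <= x u v) ->
      (forall st, st \in P -> supports_flow E x st.1 st.2) ->
      exists y : rel 'I_n,
        (forall st, st \in P -> supports_flow E (ind y) st.1 st.2) /\
        cost E w (ind y) <= k%:R * cost E w x.

End DSF.

(* A path system on the node set 'I_n is a sequence Pi (a multiset) of paths,
   each a sequence of nodes without repetition. *)
Definition path_system (n : nat) (Pi : seq (seq 'I_n)) : Prop := all uniq Pi.

Definition ps_size (n : nat) (Pi : seq (seq 'I_n)) : nat := sumn (map size Pi).

Definition prec (n : nat) (pi : seq 'I_n) (x y : 'I_n) : bool :=
  [&& x \in pi, y \in pi & index x pi < index y pi]%N.

Definition bridge (n : nat) (Pi : seq (seq 'I_n)) (b : nat) : Prop :=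
  exists (v : nat -> 'I_n) (q : nat -> nat),
    (0 < b)%N /\
    {in [pred i | (i < b)%N] &, injective v} /\
    {in [pred i | (i < b)%N] &, injective q} /\
    (forall i, (i < b)%N -> (q i < size Pi)%N) /\
    (forall i, (i.+1 < b)%N -> prec (nth [::] Pi (q i)) (v i) (v i.+1)) /\
    prec (nth [::] Pi (q b.-1)) (v 0%N) (v b.-1).

Definition bridge_free (n : nat) (Pi : seq (seq 'I_n)) : Prop :=
  forall b, ~ bridge Pi b.

(* Main.v *)
Require Import Defs.
From HB Require Import structures.
From mathcomp Require Import all_boot all_order all_algebra.
From mathcomp Require Import boolp reals.
From mathcomp Require Import zify ring lra.
Set Implicit Arguments. Unset Strict Implicit. Unset Printing Implicit Defensive.
Import Order.TTheory GRing.Theory Num.Theory.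

(** In a bridge-free system no ordered pair of nodes lies on two paths, so its size is
    at most [5/2 n sqrt p].  It therefore suffices that [DSFG(n,p) >= 1] for [p <= n] and
    [DSFG(n,p) >= n^(1/2 - o(1))] for [n <= p <= n^2/4], since [eps] can absorb the
    [o(1)] loss; the bound on [DSFG(n, n^(2-o(1)))] is then the case of a system of
    one-node paths.

    The gap instance starts from the lines [s, s+x, ..., s+lx], where [x] runs over a
    discrete paraboloid in dimension [l+1].  By strict convexity a line is the only way
    from its first point to its last one in the layered graph formed by all of them,
    although there are almost quadratically many.  Each node is blown up into [D] labels
    of unit price, and each line [q] is lifted to [D] disjoint paths by shifts [a q] in
    [Z/D].  Fractionally one buys every label to the extent [1/D].  For a fixed integral
    purchase of about [D^(1-1/(l+1))] labels per node, a typical line has a purchased lift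
    for at most half of its shifts; as there are more lines than labels, a union bound
    over all purchases yields shifts [a] for which every such purchase misses some
    line. *)

(** * Counting the shifts *)

Lemma card_bigcup_le (I T : finType) (F : I -> {set T}) :
  #|\bigcup_i F i| <= \sum_i #|F i|.
Proof.
elim/big_rec2: _ => [|i s A _ IH]; first by rewrite cards0.
by apply: leq_trans (leq_card_setU _ _) _; rewrite leq_add2l.
Qed.

Lemma exists_subset_card (T : finType) (A : {set T}) k :
  k <= #|A| -> exists2 B : {set T}, B \subset A & #|B| = k.
Proof.
move=> /card_geqP[s [us ss sA]]; exists [set x in s].
  by apply/subsetP => x; rewrite inE => /sA.
by rewrite cardsE (card_uniqP us).
Qed.

Section Labelling.

Variables (l d : nat) (W Q : finType) (g : Q -> nat -> W).
Local Notation node := ('I_l.+1 * W * 'I_d.+1)%type.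
Implicit Types (B : {set node}) (q : Q).

(* The lift [c] of the path [q] carries the label [c + t j] at layer [j]. *)
Definition lifted B q (t : {ffun 'I_l.+1 -> 'I_d.+1}) :=
  [exists c : 'I_d.+1, forall j : 'I_l.+1, (j, g q j, (c + t j)%R) \in B].

Definition fiber B (j : 'I_l.+1) (w : W) := [set c : 'I_d.+1 | (j, w, c) \in B].

(** Once the base label [c] is fixed, the layers are independent: [t j] ranges over a translate of
    the fiber. The factor [d.+1] is the union over [c]. *)
Lemma card_lifted B q :
  #|[set t | lifted B q t]| <= d.+1 * \prod_(j < l.+1) #|fiber B j (g q j)|.
Proof.
pose F (c : 'I_d.+1) := [set t : {ffun 'I_l.+1 -> 'I_d.+1} |
  [forall j : 'I_l.+1, (j, g q j, (c + t j)%R) \in B]].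
have -> : [set t | lifted B q t] = \bigcup_c F c.
  apply/setP => t; rewrite inE; apply/existsP/bigcupP => [[c hc]|[c _ hc]].
    by exists c => //; rewrite inE.
  by exists c; rewrite inE in hc.
apply: leq_trans (card_bigcup_le _) _.
have -> m : d.+1 * m = \sum_(c < d.+1) m by rewrite sum_nat_const card_ord.
apply: leq_sum => c _.
have -> : #|F c| = #|family (fun j : 'I_l.+1 => [pred b : 'I_d.+1 | (j, g q j, (c + b)%R) \in B])|.
  by apply: eq_card => t; rewrite inE; apply/forallP/familyP => h j; have := h j.
rewrite card_family foldrE big_map big_enum /=.
apply: eq_leq; apply: eq_bigr => j _.
rewrite -(card_imset _ (addrI c)); apply: eq_card => b; apply/imsetP/idP.
  by case=> b' hb' ->; rewrite inE.
by rewrite inE => hb; exists (b - c)%R; rewrite ?unfold_in /= addrCA subrr addr0.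
Qed.

Lemma sum_card_fiber B :
  \sum_(v : 'I_l.+1 * W) #|fiber B v.1 v.2| = #|B|.
Proof.
rewrite -sum1_card [RHS](partition_big (fun u => u.1) predT) //=.
apply: eq_bigr => -[j w] _; rewrite -sum1_card.
rewrite [RHS](reindex_onto (fun c => (j, w, c)) (fun u => u.2)) /=; last first.
  by case=> [[j' w'] c] /= /andP[_ /eqP->].
by apply: eq_bigl => c; rewrite inE !eqxx !andbT.
Qed.

Variables (r b D0 h : nat).
Hypothesis degg : forall (j : 'I_l.+1) w, #|[set q | g q j == w]| <= D0.
Hypothesis r_small : 2 * (d.+1 * r ^ l.+1) <= d.+1 ^ l.+1.
Hypothesis hQ : b * D0 + h <= #|Q|.
Hypothesis h_large : l.+1 * #|W| * d.+1 < h.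

(** By Markov at most [b] nodes carry more than [r] labels of [B]. Each lies on at most [D0] paths,
    so by [hQ] at least [h] paths avoid them all. *)
Lemma card_light B : #|B| <= r * b ->
  h <= #|[set q | [forall j : 'I_l.+1, #|fiber B j (g q j)| <= r]]|.
Proof.
move=> hB; pose heavy := [set v : 'I_l.+1 * W | r < #|fiber B v.1 v.2|].
have hheavy : #|heavy| <= b.
  have : #|heavy| * r.+1 <= r * b.
    apply: leq_trans hB; rewrite -sum_card_fiber -sum_nat_const.
    rewrite [X in _ <= X](bigID (mem heavy)) /=.
    by apply: leq_trans (leq_addr _ _); apply: leq_sum => v; rewrite inE.
  by nia.
set G := [set q | _].
have : #|~: G| <= #|heavy| * D0.
  apply: (@leq_trans #|\bigcup_v (if v \in heavy then [set q | g q v.1 == v.2] else set0)|).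
    apply: subset_leq_card; apply/subsetP => q; rewrite !inE negb_forall.
    case/existsP => j; rewrite -ltnNge => hj; apply/bigcupP.
    by exists (j, g q j) => //; rewrite inE hj inE /=.
  apply: leq_trans (card_bigcup_le _) _.
  rewrite -sum_nat_const [X in _ <= X]big_mkcond; apply: leq_sum => v _.
  by case: ifP => _; rewrite ?cards0.
have := cardsC G; nia.
Qed.

(** Union bound. The shifts of distinct paths are independent, and by [card_lifted] and [r_small] a
    path through light nodes only is lifted for at most half of its shifts. So a fixed small [B] is
    bad for at most a fraction [2 ^ - h] of all [a], whereas [h_large] bounds the number of sets [B]
    strictly below [2 ^ h]. *)
Lemma exists_labelling :
  exists a : {ffun Q -> {ffun 'I_l.+1 -> 'I_d.+1}},
    forall B, #|B| <= r * b -> exists q, ~~ lifted B q (a q).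
Proof.
pose small B := #|B| <= r * b.
pose bad B := [set a : {ffun Q -> {ffun 'I_l.+1 -> 'I_d.+1}} |
  small B && [forall q, lifted B q (a q)]].
have cardT : #|{: {ffun Q -> {ffun 'I_l.+1 -> 'I_d.+1}}}| = (d.+1 ^ l.+1) ^ #|Q|.
  by rewrite !card_ffun !card_ord.
have hbad B : 2 ^ h * #|bad B| <= (d.+1 ^ l.+1) ^ #|Q|.
  have [sB|nsB] := boolP (small B); last first.
    have -> : bad B = set0 by apply/setP => a; rewrite !inE (negbTE nsB).
    by rewrite cards0 muln0.
  have -> : #|bad B| = \prod_q #|[set t | lifted B q t]|.
    have -> : #|bad B| = #|family (fun q : Q => [pred t | lifted B q t])|.
      by apply: eq_card => a; rewrite inE sB; apply/forallP/familyP => ha q; have := ha q.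
    rewrite card_family foldrE big_map big_enum /=.
    by apply: eq_bigr => q _; apply: eq_card => t; rewrite inE.
  set G := [set q | [forall j : 'I_l.+1, #|fiber B j (g q j)| <= r]].
  (* One factor 2 is handed to each light path; the other paths get the trivial bound. *)
  apply: (@leq_trans (2 ^ #|G| * \prod_q #|[set t | lifted B q t]|)).
    by rewrite leq_mul2r leq_exp2l // card_light ?orbT.
  rewrite -prod_nat_const [X in X * _]big_mkcond -big_split /= -prod_nat_const.
  apply: leq_prod => q _; case: ifP => [|_].
    rewrite inE => /forallP hq; apply: leq_trans r_small.
    rewrite leq_mul2l /=; apply: leq_trans (card_lifted _ _) _.
    rewrite leq_mul2l /= -[X in _ <= _ ^ X](card_ord l.+1) -prod_nat_const.
    exact: leq_prod.
  by rewrite mul1n; apply: leq_trans (max_card _) _; rewrite card_ffun !card_ord.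
have [a ha] : exists a, a \notin \bigcup_B bad B.
  apply/existsP; rewrite -negb_forall; apply/negP => /forallP all_in.
  have : #|{: {ffun Q -> {ffun 'I_l.+1 -> 'I_d.+1}}}| <= #|\bigcup_B bad B|.
    by apply: subset_leq_card; apply/subsetP => a _.
  apply/negP; rewrite -ltnNge cardT.
  apply: leq_ltn_trans (card_bigcup_le _) _.
  rewrite -(ltn_pmul2l (expn_gt0 2 h)) big_distrr /=.
  apply: leq_ltn_trans (leq_sum _ _) _; first by move=> B _; exact: hbad.
  rewrite sum_nat_const ltn_pmul2r ?expn_gt0 //.
  have -> : #|{set node}| = 2 ^ (l.+1 * #|W| * d.+1).
    by have := card_powerset [set: node]; rewrite powersetT !cardsT !card_prod !card_ord.
  by rewrite ltn_exp2l.
exists a => B sB; apply/existsP; rewrite -negb_forall; apply: contra ha => hl.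
by apply/bigcupP; exists B; rewrite // inE [small B]sB.
Qed.

End Labelling.

(** * Lines in paraboloid directions *)

Section Paraboloid.

Variables (l k b : nat).
Hypothesis k_gt0 : 0 < k.
Local Notation B := b.+1.
Local Notation H := (k * B ^ 2).
Local Notation dir := {ffun 'I_k -> 'I_B}.

(** A line [((s, e), x)] starts at [(s, e)] and has direction [(x, sqnorm x)], a point of the
    paraboloid. The ranges in [point] are just wide enough for [line_pt q j] with [j <= l]; the form
    [.-1.+1] lets [inord] produce the last coordinate. *)
Definition line : finType := (dir * 'I_H * dir)%type.
Definition point : finType := ({ffun 'I_k -> 'I_(l * B + b).+1} * 'I_(l.+1 * H).-1.+1)%type.

Definition sqnorm (x : dir) := \sum_t x t ^ 2.

Definition line_pt (q : line) (j : nat) : point :=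
  ([ffun t => inord (q.1.1 t + j * q.2 t)], inord (q.1.2 + j * sqnorm q.2)).

Lemma sqnorm_le x : sqnorm x <= H.
Proof.
rewrite -[X in X * _](card_ord k) -sum_nat_const; apply: leq_sum => t _.
by rewrite leq_exp2r // ltnW.
Qed.

Lemma line_pt1 q j t : j <= l -> (line_pt q j).1 t = q.1.1 t + j * q.2 t :> nat.
Proof.
move=> jl; rewrite ffunE inordK // ltnS addnC leq_add //; last by rewrite -ltnS.
by apply: leq_mul => //; apply: ltnW.
Qed.

Lemma line_pt2 q j : j <= l -> (line_pt q j).2 = q.1.2 + j * sqnorm q.2 :> nat.
Proof.
have H0 : 0 < H by rewrite muln_gt0 k_gt0 expn_gt0.
have HL : 0 < l.+1 * H by rewrite muln_gt0 H0.
move=> jl; rewrite inordK // prednK //.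
by rewrite mulSn -addSn leq_add // leq_mul // sqnorm_le.
Qed.

(* Strict convexity of the squared norm: an average of points of the paraboloid
   lies on the paraboloid only if they all agree. *)
Lemma line_pt_unique (q : line) (h : nat -> line) (w : nat -> point) :
  w 0 = line_pt q 0 -> w l = line_pt q l ->
  (forall i, i < l -> line_pt (h i) i = w i /\ line_pt (h i) i.+1 = w i.+1) ->
  forall i, i < l -> h i = q.
Proof.
move=> w0 wl hw.
have w1 i t : i <= l -> (w i).1 t = q.1.1 t + \sum_(i' < i) (h i').2 t :> nat.
  elim: i => [|i IH] il; first by rewrite big_ord0 w0 line_pt1.
  have [e1 e2] := hw i il; rewrite big_ord_recr /= addnA -IH ?(ltnW il) //.
  by rewrite -e1 -e2 !line_pt1 ?(ltnW il) // mulSnr addnA.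
have w2 i : i <= l -> (w i).2 = q.1.2 + \sum_(i' < i) sqnorm (h i').2 :> nat.
  elim: i => [|i IH] il; first by rewrite big_ord0 w0 line_pt2.
  have [e1 e2] := hw i il; rewrite big_ord_recr /= addnA -IH ?(ltnW il) //.
  by rewrite -e1 -e2 !line_pt2 ?(ltnW il) // mulSnr addnA.
have s1 t : \sum_(i < l) (h i).2 t = l * q.2 t.
  by have := w1 l t (leqnn l); rewrite wl line_pt1 // => /addnI.
have s2 : \sum_(i < l) sqnorm (h i).2 = l * sqnorm q.2.
  by have := w2 l (leqnn l); rewrite wl line_pt2 // => /addnI.
(* Summed over all steps and coordinates, both sides of [2 x y <= x ^ 2 + y ^ 2] equal
   [2 * l * sqnorm q.2], by [s1] and [s2]. Hence equality holds in every term. *)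
have x_eq (i : 'I_l) t : (h i).2 t = q.2 t :> nat.
  have C : \sum_(it : 'I_l * 'I_k) 2 * ((h it.1).2 it.2 * q.2 it.2) <=
      \sum_(it : 'I_l * 'I_k) ((h it.1).2 it.2 ^ 2 + q.2 it.2 ^ 2)
      ?= iff [forall it : 'I_l * 'I_k, true ==> ((h it.1).2 it.2 == q.2 it.2 :> nat)].
    by apply: leqif_sum => it _; apply: nat_Cauchy.
  have : [forall it : 'I_l * 'I_k, true ==> ((h it.1).2 it.2 == q.2 it.2 :> nat)].
    rewrite -C.2; apply/eqP.
    rewrite -(pair_bigA _ (fun (i : 'I_l) (t : 'I_k) => 2 * ((h i).2 t * q.2 t))) /=.
    rewrite -(pair_bigA _ (fun (i : 'I_l) (t : 'I_k) => ((h i).2 t ^ 2 + q.2 t ^ 2))) /=.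
    rewrite [LHS]exchange_big /=.
    under eq_bigr do rewrite -big_distrr -big_distrl /= s1.
    under [RHS]eq_bigr do rewrite big_split /=.
    rewrite [RHS]big_split /=.
    have -> : \sum_(i < l) \sum_t (h i).2 t ^ 2 = l * sqnorm q.2 by exact: s2.
    rewrite sum_nat_const card_ord -/(sqnorm q.2) /sqnorm addnn -mul2n big_distrr /= big_distrr /=.
    by apply: eq_bigr => t0 _; rewrite -mulnA mulnn.
  by move=> /forallP/(_ (i, t))/eqP.
move=> i il; have x_eqi : (h i).2 = q.2.
  by apply/ffunP => t; apply: val_inj; apply: (x_eq (Ordinal il)).
have x_eqs (j : nat) : j < i -> (h j).2 = q.2.
  move=> ji; apply/ffunP => t; apply: val_inj.
  exact: (x_eq (Ordinal (ltn_trans ji il))).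
(* With all directions equal to that of [q], cancelling [i] steps identifies the starting points. *)
have [e1 _] := hw i il; move: (ltnW il) => il'.
have -> : q = (q.1.1, q.1.2, q.2) by case: (q) => [[]].
rewrite -x_eqi; case E : (h i) => [[s e] x] /=; congr (_, _, _).
  apply/ffunP => t; apply: val_inj => /=; have := w1 i t il'.
  rewrite -e1 line_pt1 // (eq_bigr (fun=> q.2 t : nat)); last first.
    by move=> j _; rewrite x_eqs.
  by rewrite sum_nat_const card_ord x_eqi E /= => /addIn.
apply: val_inj => /=; have := w2 i il'.
rewrite -e1 line_pt2 // (eq_bigr (fun=> sqnorm q.2)); last first.
  by move=> j _; rewrite x_eqs.
by rewrite sum_nat_const card_ord x_eqi E /= => /addIn.
Qed.

(** A line is determined by its direction and its point in layer [j]. *)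
Lemma card_lines_through (j : 'I_l.+1) w :
  #|[set q | line_pt q j == w]| <= B ^ k.
Proof.
have jl : j <= l by rewrite -ltnS.
have inj : {in [set q | line_pt q j == w] &, injective (fun q : line => q.2)}.
  move=> [[s e] x] [[s' e'] x']; rewrite !inE => /eqP e1 /eqP e2 /= xx'.
  subst x'; congr (_, _, _).
    apply/ffunP => t; apply: val_inj.
    have := line_pt1 (s, e, x) t jl; rewrite e1 -e2 line_pt1 //= => /addIn.
    by move=> ->.
  apply: val_inj; have := line_pt2 (s, e, x) jl; rewrite e1 -e2 line_pt2 //= => /addIn.
  by move=> ->.
rewrite -(card_in_imset inj); apply: leq_trans (max_card _) _.
by rewrite card_ffun !card_ord.
Qed.

Lemma card_line : #|line| = H * B ^ k * B ^ k.
Proof. by rewrite !card_prod card_ffun !card_ord [_ * H]mulnC. Qed.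

(** Lines thus outnumber points by the factor [B ^ k / l.+1 ^ k.+1], which has to beat the number of
    labels per point. *)
Lemma card_point : #|point| = l.+1 ^ k.+1 * (H * B ^ k).
Proof.
have H0 : 0 < H by rewrite muln_gt0 k_gt0 expn_gt0.
have HL : 0 < l.+1 * H by rewrite muln_gt0 H0.
rewrite card_prod card_ffun !card_ord prednK //.
have -> : (l * B + b).+1 = l.+1 * B by rewrite mulSn; lia.
by rewrite expnMn mulnACA -expnSr [_ ^ k * H]mulnC.
Qed.

End Paraboloid.

(** * Flows over finite types *)

Section FlowOnFinType.

Variable R : realType.
Local Open Scope ring_scope.

(** Flows are restated over a finite type because the gap instance has structured vertices;
    [enum_rank] carries them to and from ordinals. *)
Definition flow_on (T : finType) (E : rel T) (x : T -> T -> R) (s t : T) : Prop :=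
  exists f : T -> T -> R,
    [/\ forall u v, 0 <= f u v <= x u v,
        forall u v, ~~ E u v -> f u v = 0 &
        forall v, \sum_u f v u - \sum_u f u v = (v == s)%:R - (v == t)%:R].

Definition cost_on (T : finType) (E : rel T) (w x : T -> T -> R) : R :=
  \sum_u \sum_(v | E u v) w u v * x u v.

Lemma sum_enum_val (T : finType) (P : pred T) (F : T -> R) :
  \sum_(i < #|T| | P (enum_val i)) F (enum_val i) = \sum_(u | P u) F u.
Proof. by rewrite -big_enum_val_cond. Qed.

Lemma supports_flow_enum_val (T : finType) (E : rel T) (x : T -> T -> R) s t :
  flow_on E x s t ->
  supports_flow (fun u v => E (enum_val u) (enum_val v))
    (fun u v => x (enum_val u) (enum_val v)) (enum_rank s) (enum_rank t).
Proof.
case=> f [f1 f2 f3]; exists (fun u v => f (enum_val u) (enum_val v)); split.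
  by move=> u v; apply/andP.
split=> [u v|v]; first exact: f2.
rewrite -[in RHS](enum_valK v) !(inj_eq enum_rank_inj) -f3.
congr (_ - _); first exact: (sum_enum_val xpredT (f (enum_val v))).
exact: (sum_enum_val xpredT (f^~ (enum_val v))).
Qed.

Lemma flow_on_enum_val (T : finType) (E : rel T)
    (x : 'I_#|T| -> 'I_#|T| -> R) s t :
  supports_flow (fun u v => E (enum_val u) (enum_val v)) x (enum_rank s) (enum_rank t) ->
  flow_on E (fun u v => x (enum_rank u) (enum_rank v)) s t.
Proof.
case=> f [f1 [f2 f3]]; exists (fun u v => f (enum_rank u) (enum_rank v)); split.
- by move=> u v; apply/andP; apply: f1.
- by move=> u v nE; apply: f2; rewrite !enum_rankK.
move=> v; have := f3 (enum_rank v); rewrite !(inj_eq enum_rank_inj) => <-.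
congr (_ - _).
  rewrite -(sum_enum_val xpredT (fun u => f (enum_rank v) (enum_rank u))).
  by apply: eq_bigr => i _; rewrite enum_valK.
rewrite -(sum_enum_val xpredT (fun u => f (enum_rank u) (enum_rank v))).
by apply: eq_bigr => i _; rewrite enum_valK.
Qed.

Lemma DSFG_ok_finType (T : finType) p k : DSFG_ok R #|T| p k ->
  forall (E : rel T) (w : T -> T -> R) (P : {set T * T}),
    (forall u v, E u v -> 0 <= w u v) -> #|P| = p ->
    forall x : T -> T -> R, (forall u v, 0 <= x u v) ->
      (forall s t, (s, t) \in P -> flow_on E x s t) ->
      exists y : rel T,
        (forall s t, (s, t) \in P -> flow_on E (fun u v => (y u v)%:R) s t) /\
        cost_on E w (fun u v => (y u v)%:R) <= k%:R * cost_on E w x.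
Proof.
move=> ok E w P w0 cP x x0 fP.
pose rk (u : T * T) := (enum_rank u.1, enum_rank u.2).
have rk_inj : injective rk by move=> [a b] [c e] [/enum_rank_inj-> /enum_rank_inj->].
have [||||y [fy cy]] := ok (fun u v => E (enum_val u) (enum_val v))
  (fun u v => w (enum_val u) (enum_val v)) (rk @: P) _ _
  (fun u v => x (enum_val u) (enum_val v)).
- by move=> u v; apply: w0.
- by rewrite card_imset.
- by move=> u v; apply: x0.
- move=> _ /imsetP[[s t] sP ->]; apply: supports_flow_enum_val; exact: fP.
exists (fun u v => y (enum_rank u) (enum_rank v)); split.
  move=> s t sP; apply: (flow_on_enum_val (x := ind R y)).
  by apply: (fy (rk (s, t))); apply: imset_f.
have cE z : cost (fun u v => E (enum_val u) (enum_val v))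
    (fun u v => w (enum_val u) (enum_val v)) z
  = cost_on E w (fun u v => z (enum_rank u) (enum_rank v)).
  rewrite /cost_on -(sum_enum_val xpredT
    (fun u => \sum_(v | E u v) w u v * z (enum_rank u) (enum_rank v))).
  apply: eq_bigr => u _; rewrite -[RHS]sum_enum_val.
  by apply: eq_bigr => v _; rewrite !enum_valK.
rewrite !cE in cy; apply: le_trans cy _.
rewrite ler_wpM2l // /cost_on; apply: ler_sum => u _; apply: ler_sum => v _.
by rewrite !enum_rankK.
Qed.

(** The flow is the average of the walks: conservation telescopes along each walk, and the capacity
    condition counts traversals. *)
Lemma walks_flow (T I : finType) (E : rel T) (x : T -> T -> R) (s t : T)
    (m : nat) (walk : I -> nat -> T) :
  (0 < #|I|)%N -> (forall c, walk c 0%N = s) -> (forall c, walk c m = t) ->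
  (forall c i, (i < m)%N -> E (walk c i) (walk c i.+1)) ->
  (forall u v, 0 <= x u v) ->
  (forall u v, E u v ->
     #|[set ci : I * 'I_m | (walk ci.1 ci.2 == u) && (walk ci.1 ci.2.+1 == v)]|%:R
       <= #|I|%:R * x u v) ->
  flow_on E x s t.
Proof.
move=> I0 ws wt wE x0 wx.
have I0R : 0 < #|I|%:R :> R by rewrite ltr0n.
pose f u v : R := #|I|%:R^-1 *
  \sum_(ci : I * 'I_m) ((walk ci.1 ci.2 == u) && (walk ci.1 ci.2.+1 == v))%:R.
have f0 u v : 0 <= f u v.
  by rewrite mulr_ge0 ?invr_ge0 ?ler0n // sumr_ge0 // => ci _; rewrite ler0n.
have fE u v : ~~ E u v -> f u v = 0.
  move=> nE; rewrite /f big1 ?mulr0 // => -[c i] _ /=.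
  have [wu|//] := eqVneq (walk c i) u; have [wv|//] := eqVneq (walk c i.+1) v.
  by have := wE c i (ltn_ord i); rewrite wu wv (negbTE nE).
exists f; split => // [u v|v].
  rewrite f0 /=; have [Euv|nE] := boolP (E u v); last by rewrite fE.
  rewrite /f mulrC ler_pdivrMr // mulrC -natr_sum; apply: le_trans (wx u v Euv).
  rewrite ler_nat -sum1dep_card [X in (_ <= X)%N]big_mkcond /=.
  by apply: leq_sum => ci _; case: (_ && _).
have out : \sum_u f v u = #|I|%:R^-1 * \sum_c \sum_(i < m) (walk c i == v)%:R.
  rewrite /f -big_distrr /=; congr (_ * _); rewrite [LHS]exchange_big [RHS]pair_bigA /=.
  apply: eq_bigr => -[c i] _ /=.
  rewrite (bigD1 (walk c i.+1)) //= eqxx andbT big1 ?addr0 // => u.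
  by rewrite eq_sym => /negbTE->; rewrite andbF.
have inc : \sum_u f u v = #|I|%:R^-1 * \sum_c \sum_(i < m) (walk c i.+1 == v)%:R.
  rewrite /f -big_distrr /=; congr (_ * _); rewrite [LHS]exchange_big [RHS]pair_bigA /=.
  apply: eq_bigr => -[c i] _ /=.
  rewrite (bigD1 (walk c i)) //= eqxx /= big1 ?addr0 // => u.
  by rewrite eq_sym => /negbTE->.
rewrite out inc -mulrBr -sumrB.
rewrite (eq_bigr (fun=> (v == s)%:R - (v == t)%:R)) => [|c _].
  by rewrite sumr_const -[X in _ * X]mulr_natl mulKf // gt_eqF.
rewrite -sumrB -(big_mkord xpredT (fun i => (walk c i == v)%:R - (walk c i.+1 == v)%:R)).
rewrite (eq_bigr (fun i => - ((walk c i.+1 == v)%:R - (walk c i == v)%:R))); last first.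
  by move=> i _; rewrite opprB.
rewrite sumrN (telescope_sumr (fun i => (walk c i == v)%:R)) // opprB ws wt.
by rewrite ![v == _]eq_sym.
Qed.

(** Cut argument: if [t] were outside [A], the net flow out of [A] would be 1, but no chosen edge
    leaves [A]. *)
Lemma flow_closed (T : finType) (E y : rel T) (s t : T) (A : {set T}) :
  flow_on E (fun u v => (y u v)%:R) s t -> s \in A ->
  (forall u v, u \in A -> E u v -> y u v -> v \in A) -> t \in A.
Proof.
case=> f [f1 f2 f3] sA clA; apply/negPn/negP => tA.
have f0 u v : u \in A -> v \notin A -> f u v = 0.
  move=> uA vA; have [Euv|/f2//] := boolP (E u v).
  have [yuv|nyuv] := boolP (y u v); first by rewrite (clA u v) in vA.
  by have := f1 u v; rewrite (negbTE nyuv) -eq_le eq_sym => /eqP.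
have : \sum_(v in A) (\sum_u f v u - \sum_u f u v) = 1.
  rewrite (eq_bigr (fun v => (v == s)%:R)) => [|v vA].
    rewrite (bigD1 s) //= eqxx big1 ?addr0 // => v /andP[_].
    by move/negbTE->.
  rewrite f3; have [vt|] := eqVneq v t; last by rewrite subr0.
  by rewrite vt (negbTE tA) in vA.
rewrite sumrB.
have -> : \sum_(v in A) \sum_u f v u = \sum_(v in A) \sum_(u in A) f v u.
  apply: eq_bigr => v vA; rewrite (bigID (mem A)) /= [X in _ + X]big1 ?addr0 //.
  by move=> u; apply: f0.
rewrite exchange_big /= -sumrB => e1.
(* Flow inside [A] cancels; what remains is minus the flow that enters [A]. *)
have : \sum_(v in A) (\sum_(u in A) f u v - \sum_u f u v) <= 0.
  apply: sumr_le0 => v vA; rewrite subr_le0 [X in _ <= X](bigID (mem A)) /=.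
  by rewrite lerDl sumr_ge0 // => u _; case/andP: (f1 u v).
by rewrite e1 ler10.
Qed.

End FlowOnFinType.

(** * The gap instance *)

Section GapInstance.

Variables (R : realType) (l d e : nat) (W Q : finType) (g : Q -> nat -> W).
Variable a : {ffun Q -> {ffun 'I_l.+1 -> 'I_d.+1}}.
Hypothesis l_gt0 : 0 < l.
Hypothesis g_unique : forall (q : Q) (h : nat -> Q) (w : nat -> W),
  w 0 = g q 0 -> w l = g q l ->
  (forall i, i < l -> g (h i) i = w i /\ g (h i) i.+1 = w i.+1) ->
  forall i, i < l -> h i = q.

Local Notation node := ('I_l.+1 * W * 'I_d.+1)%type.

(* The last summand consists of idle nodes, used to pad the set of demands. *)
Definition vertex : finType := (W + W + node * bool + 'I_e)%type.

Lemma card_vertex :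
  #|vertex| = #|W| + #|W| + l.+1 * #|W| * d.+1 * 2 + e.
Proof. by rewrite !card_sum !card_prod !card_ord card_bool. Qed.

Definition src (w : W) : vertex := inl (inl (inl w)).
Definition snk (w : W) : vertex := inl (inl (inr w)).
(** Each node is split in two, so that its price can sit on the edge from [nin v] to [nout v]. *)
Definition nin (v : node) : vertex := inl (inr (v, false)).
Definition nout (v : node) : vertex := inl (inr (v, true)).

(** Only label differences are compared, so every lift [c + a q j] of [q] runs along links, whatever
    the base label [c]. *)
Definition link (u v : node) :=
  (v.1.1 == u.1.1.+1 :> nat) &&
  [exists q, [&& g q u.1.1 == u.1.2, g q v.1.1 == v.1.2 &
              (v.2 - u.2 == a q v.1.1 - a q u.1.1)%R]].

Definition edge (x y : vertex) : bool :=
  match x, y with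
  | inl (inl (inl w)), inl (inr (v, false)) => (v.1.1 == ord0) && (v.1.2 == w)
  | inl (inr (u, false)), inl (inr (v, true)) => u == v
  | inl (inr (u, true)), inl (inr (v, false)) => link u v
  | inl (inr (u, true)), inl (inl (inr w)) => (u.1.1 == ord_max) && (u.1.2 == w)
  | inr _, inr _ => true
  | _, _ => false
  end.

Definition paid (x y : vertex) : bool :=
  match x, y with
  | inl (inr (_, false)), inl (inr (_, true)) => true
  | _, _ => false
  end.

Definition weight (x y : vertex) : R := (paid x y)%:R%R.

(** Two edges to enter and cross each of the [l.+1] layers, and one to the sink. *)
Definition steps := (2 * l.+1).+1.

(** Unpaid edges cost nothing, so the length of a walk serves as a crude capacity there. *)
Definition frac (x y : vertex) : R :=
  (if paid x y then d.+1%:R^-1 else steps%:R)%R.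

Definition bought (y : rel vertex) : {set node} := [set v | y (nin v) (nout v)].

Lemma cost_weight (z : vertex -> vertex -> R) :
  cost_on edge weight z = (\sum_v z (nin v) (nout v))%R.
Proof.
pose F (x : vertex) : R :=
  match x with inl (inr (v, false)) => z (nin v) (nout v) | _ => 0%R end.
rewrite /cost_on (eq_bigr F); last first.
  have zero x : (forall y, ~~ paid x y) ->
      (\sum_(y | edge x y) weight x y * z x y = 0)%R.
    by move=> np; rewrite big1 // => y _; rewrite /weight (negbTE (np y)) mul0r.
  case=> [[[w|w]|[v []]]|i] _; try by apply: zero; case=> [[[]|[? []]]|].
  rewrite (big_pred1 (nout v)) ?mul1r //.
  case=> [[[w|w]|[u []]]|j] //=.
    by apply/eqP/eqP => [->//|[->]].
  by apply/esym/eqP => -[].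
rewrite !big_sumType /= !sumr_const !mul0rn addr0 !add0r.
rewrite (eq_bigr (fun i => F (inl (inr (i.1, i.2))))) => [|[v b] _ //].
rewrite -(pair_bigA _ (fun v b => F (inl (inr (v, b))))) /=.
by apply: eq_bigr => v _; rewrite big_bool /= add0r.
Qed.

Lemma cost_bought (y : rel vertex) :
  cost_on edge weight (fun u v => (y u v)%:R%R) = (#|bought y|%:R)%R.
Proof.
rewrite cost_weight -natr_sum; congr (_%:R)%R; rewrite -sum1_card big_mkcond /=.
rewrite [RHS]big_mkcond /=.
by apply: eq_bigr => v _; rewrite inE; case: (y _ _).
Qed.

Lemma cost_frac : cost_on edge weight frac = ((l.+1 * #|W|)%:R)%R.
Proof.
rewrite cost_weight sumr_const /frac /= !card_prod !card_ord.
by rewrite -[LHS]mulr_natl [X in (X * _)%R]natrM mulfK // pnatr_eq0.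
Qed.

(** The lift of [q] with base label [c]: positions [2 j + 1] and [2 j + 2] are the two halves of its
    node in layer [j]. *)
Definition walk (q : Q) (c : 'I_d.+1) (i : nat) : vertex :=
  if i == 0 then src (g q 0) else if i == steps then snk (g q l) else
  inl (inr ((inord i.-1./2, g q i.-1./2, (c + a q (inord i.-1./2))%R), ~~ odd i)).

Lemma walk_edge q c i : i < steps -> edge (walk q c i) (walk q c i.+1).
Proof.
rewrite /walk; have : steps = (2 * l.+1).+1 by []; move: steps => [//|N] [hN].
rewrite !eqSS; case: i => [|i] /=.
  have -> : (0 == N) = false by apply/eqP; lia.
  by move=> _; rewrite /= -val_eqE /= inordK // !eqxx.
rewrite !eqSS ltnS => il.
have -> : (i == N) = false by apply/eqP; lia.
(* For odd [i] the position [i.+1] is an out half, followed by the sink or the next layer; for even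
   [i] the edge crosses a node. *)
have := odd_double_half i; case: (odd i) => /=.
  set j := i./2 => ji.
  have [il'|il'] := eqVneq i.+1 N.
    have -> : j = l by lia.
    by rewrite /= -val_eqE /= inordK // !eqxx.
  have -> : uphalf i = j.+1 by rewrite uphalf_half -/j; lia.
  have jl : j.+1 < l.+1 by lia.
  rewrite /= /link /= !inordK //; last by lia.
  rewrite eqxx /=; apply/existsP; exists q; rewrite !eqxx /=.
  by rewrite opprD addrACA subrr add0r.
set j := i./2 => ji.
have -> : (i.+1 == N) = false by apply/eqP; lia.
have -> : uphalf i = j by rewrite uphalf_half -/j; lia.
by rewrite /=.
Qed.

(** The lifts of one path are disjoint: the layer of [v] gives the position, and subtracting the
    shift at that layer from the label gives [c]. *)
Lemma walk_paid_inj q c c' i i' v : i < steps -> i' < steps ->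
  walk q c i = nin v -> walk q c' i' = nin v -> c = c' /\ i = i'.
Proof.
have main c0 i0 : i0 < steps -> walk q c0 i0 = nin v ->
    i0 = v.1.1.*2.+1 /\ v = (v.1.1, g q v.1.1, c0 + a q v.1.1)%R.
  rewrite /walk; case: i0 => [|i0] //= i0s.
  case: ifP => // _ [<-] /= /negPn oi.
  have hi : i0./2 < l.+1 by have := odd_double_half i0; rewrite /steps in i0s; lia.
  rewrite !inordK //=; split => //; have := odd_double_half i0; move: oi => /=.
  by case: (odd i0) => //= _; lia.
move=> hi hi' /(main _ _ hi)[-> e1] /(main _ _ hi')[-> e2]; split => //.
have := congr1 snd e1; rewrite {1}e2 /= => /addIr->//.
Qed.

Lemma frac_ge0 u v : (0 <= frac u v)%R.
Proof. by rewrite /frac; case: ifP => _; rewrite ?invr_ge0 ler0n. Qed.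

(** Average the [d.+1] lifts of [q]; by [walk_paid_inj] at most one of them crosses a given paid
    edge. *)
Lemma flow_frac q : flow_on edge frac (src (g q 0)) (snk (g q l)).
Proof.
apply: (@walks_flow _ _ _ _ _ _ _ steps (walk q)).
- by rewrite card_ord.
- by [].
- by move=> c; rewrite /walk /= eqxx.
- exact: walk_edge.
- exact: frac_ge0.
move=> u v _; rewrite /frac card_ord; case: ifP => [puv|_].
  rewrite mulfV ?pnatr_eq0 // (ler_nat _ _ 1); apply/card_le1_eqP => -[c i] [c' i'].
  rewrite !inE /= => /andP[/eqP w1 _] /andP[/eqP w2 _].
  have [x ux] : exists x, u = nin x.
    by case: u puv {w1 w2} => [[//|[x []]]|//] //= _; exists x.
  rewrite ux in w1 w2.
  have [-> ii] := walk_paid_inj (ltn_ord i) (ltn_ord i') w1 w2.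
  by congr (_, _); apply: val_inj.
rewrite -natrM ler_nat; apply: leq_trans (max_card _) _.
by rewrite card_prod !card_ord.
Qed.

Lemma flow_idle (i j : 'I_e) : flow_on edge frac (inr i) (inr j).
Proof.
apply: (@walks_flow _ _ unit _ _ _ _ 1 (fun _ k => if k == 0 then inr i else inr j)) => //.
- by rewrite card_unit.
- by move=> _ [].
- exact: frac_ge0.
move=> u v _; rewrite card_unit mul1r /frac; case: ifP => [puv|_].
  suff -> : [set ci : unit * 'I_1 | ((if ci.2 == 0 :> nat then inr i else inr j) == u)
       && (inr j == v)] = set0 by rewrite cards0 invr_ge0 ler0n.
  apply/setP => -[c k]; rewrite !inE; case: u puv => [[//|[x []]]|//] //= _.
  by case: ifP.
rewrite ler_nat; apply: leq_trans (max_card _) _.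
by rewrite card_prod card_unit card_ord.
Qed.

Section Reach.

Variables (q : Q) (y : rel vertex).

(** The path may change at every layer: [h i] is the one followed from layer [i] to [i.+1]. The node
    in layer [j] itself need not be bought, since only its in half has been reached. *)
Definition trace (j : nat) (w : W) (c : 'I_d.+1) : Prop :=
  exists (wd : nat -> W) (h : nat -> Q) (lab : nat -> 'I_d.+1),
    [/\ wd 0 = g q 0, wd j = w, lab j = c & forall i, i < j ->
      [/\ g (h i) i = wd i, g (h i) i.+1 = wd i.+1,
          (lab i.+1 - lab i = a (h i) (inord i.+1) - a (h i) (inord i))%R &
          (inord i, wd i, lab i) \in bought y]].

(** This is the closed set to which [flow_closed] will be applied. *)
Definition reached (u : vertex) : Prop :=
  match u with
  | inl (inl (inl w)) => w = g q 0
  | inl (inl (inr w)) => exists2 c, trace l w c & (ord_max, w, c) \in bought y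
  | inl (inr (v, b)) => trace v.1.1 v.1.2 v.2 /\ (b -> v \in bought y)
  | inr _ => False
  end.

Lemma trace_extend (j : nat) w c w' c' q' :
  j < l -> trace j w c -> (inord j, w, c) \in bought y ->
  g q' j = w -> g q' j.+1 = w' ->
  (c' - c = a q' (inord j.+1) - a q' (inord j))%R -> trace j.+1 w' c'.
Proof.
move=> jl [wd [h [lab [w0 wj labj hi]]]] b gj gj' cc.
exists (fun i => if i <= j then wd i else w'), (fun i => if i < j then h i else q'),
  (fun i => if i <= j then lab i else c'); split => //=; rewrite ?ltnn // => i ij.
have [ilj|jli] := ltnP i j.
  by rewrite ltnW //; apply: hi.
have -> : i = j by lia.
by rewrite leqnn; split; rewrite ?wj ?labj.
Qed.

Lemma reached_closed u v : reached u -> edge u v -> y u v -> reached v.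
Proof.
case: u => [[[w|w]|[[[j w] c] b]]|i] //=;
  case: v => [[[w'|w']|[[[j' w'] c'] b']]|i'] //=.
- case: b' => // -> /andP[/eqP-> /eqP->] _; split => //.
  by exists (fun=> g q 0), (fun=> q), (fun=> c').
- by case: b.
- case: b => // -[tr hb] /andP[/eqP jm /eqP <-] _; exists c.
    by rewrite jm in tr.
  by rewrite -jm; apply: hb.
- case: b b' => [] [] //.
    case=> tr /(_ isT) hb /andP[/= /eqP jj /existsP[q' /and3P[/eqP g1 /eqP g2 /eqP aa]]] _.
    split => //; rewrite jj; have jl : j < l by have := ltn_ord j'; rewrite jj.
    have ej : inord j = j by apply: val_inj; rewrite /= inordK.
    have ej' : inord j.+1 = j' by apply: val_inj; rewrite /= inordK // jj.
    apply: (trace_extend jl tr _ g1); rewrite ?ej //.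
      by rewrite -jj.
    by rewrite ej'.
  case=> tr _ /eqP[<- <- <-] hy; split => // _.
  by rewrite inE.
- by case: b.
Qed.

(** The sink is reached by some trace. By [g_unique] the trace follows [q] throughout, and its
    labels telescope to a lift with base label [lab 0 - a q 0]. *)
Lemma flow_lifted :
  flow_on edge (fun u v => (y u v)%:R%R : R) (src (g q 0)) (snk (g q l)) ->
  lifted g (bought y) q (a q).
Proof.
move=> fl; have := flow_closed (A := [set u | `[< reached u >]]) fl.
rewrite !inE => /(_ _ _)/asboolP[]; first exact/asboolP.
  move=> u v; rewrite !inE => /asboolP ru Euv yuv.
  by apply/asboolP; apply: reached_closed Euv yuv.
move=> c [wd [h [lab [w0 wl labl hi]]]] bl.
have hq : forall i, i < l -> h i = q.
  by apply: (g_unique w0 wl) => i /hi[].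
have wdE i : i <= l -> wd i = g q i.
  case: i => [|i] il //; have [_ <- _ _] := hi i il.
  by rewrite hq.
have labE i : i <= l -> lab i = (lab 0 - a q (inord 0) + a q (inord i))%R.
  elim: i => [|i IH] il; first by rewrite subrK.
  have [_ _ e1 _] := hi i il; rewrite hq // in e1.
  have -> : lab i.+1 = (a q (inord i.+1) - a q (inord i) + lab i)%R.
    by rewrite -e1 subrK.
  by rewrite IH ?(ltnW il) // addrC -addrA; congr (_ + _)%R;
     rewrite addrCA subrr addr0.
apply/existsP; exists (lab 0 - a q (inord 0))%R; apply/forallP => j.
have jl : j <= l by rewrite -ltnS.
have ej : inord j = j by apply: val_inj; rewrite /= inordK.
have -> : (lab 0 - a q (inord 0) + a q j = lab j)%R by rewrite (labE j jl) ej.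
rewrite -wdE //; move: jl; rewrite leq_eqVlt => /orP[/eqP jl|jl].
  have -> : j = ord_max by apply: val_inj.
  by rewrite /= wl labl.
by have [_ _ _] := hi j jl; rewrite ej.
Qed.

End Reach.

(** The fractional solution costs [l.+1 * #|W|]. If [k] times this were at most [s], the integral
    solution would buy at most [s] nodes and, by [flow_lifted], contain a lift of every path. Idle
    pairs bring the number of demands up to exactly [p]. *)
Lemma gap_instance (n p k s : nat) :
  (forall B : {set node}, #|B| <= s -> exists q, ~~ lifted g B q (a q)) ->
  #|vertex| = n -> #|Q| <= p <= #|Q| + e ^ 2 ->
  DSFG_ok R n p k -> s < k * (l.+1 * #|W|).
Proof.
move=> ha <- /andP[Qp pe] ok; rewrite ltnNge; apply/negP => ks.
pose dem q := (src (g q 0), snk (g q l)).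
(* Uniqueness, applied to the constant sequence [q], shows that the two end points determine the
   path. *)
have dem_inj : injective dem.
  move=> q q' [e0 el].
  exact: (@g_unique q' (fun=> q) (g q) e0 el (fun _ _ => conj erefl erefl) 0).
pose idle := [set ((inr i.1 : vertex), (inr i.2 : vertex)) | i : 'I_e * 'I_e].
have [P1 sP1 cP1] : exists2 P1 : {set vertex * vertex}, P1 \subset idle & #|P1| = p - #|Q|.
  apply: exists_subset_card; rewrite card_imset; last by move=> [? ?] [? ?] [-> ->].
  by rewrite card_prod card_ord mulnn; lia.
have dis : [disjoint [set dem q | q : Q] & P1].
  apply/pred0P => u /=; apply/negP => /andP[/imsetP[q _ ->]] /(subsetP sP1).
  by case/imsetP.
have [||||y [fy cy]] := @DSFG_ok_finType _ _ _ _ ok edge weight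
    ([set dem q | q : Q] :|: P1) _ _ frac.
- by move=> u v _; rewrite ler0n.
- by rewrite cardsU disjoint_setI0 // cards0 subn0 card_imset // cP1 subnKC.
- exact: frac_ge0.
- move=> u v; rewrite inE => /orP[/imsetP[q _ [-> ->]]|/(subsetP sP1)/imsetP[[i j] _ [-> ->]]].
    exact: flow_frac.
  exact: flow_idle.
have : #|bought y| <= s.
  apply: leq_trans ks; rewrite -(ler_nat R) -cost_bought natrM -cost_frac.
  exact: cy.
case/ha => q /negP; apply; apply: flow_lifted; apply: fy.
by rewrite inE imset_f.
Qed.

End GapInstance.

(** With [L = l.+1], take dimension [L], side [B = 4 L^2 m], [D = (2 m)^L] labels and threshold
    [r = m^l]. There are about [m^(L+2)] points, hence about [m^(2L+2)] labelled nodes, and as many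
    lines up to constants. *)
Lemma DSFG_power_gap (R : realType) (l : nat) : 0 < l ->
  exists2 K : nat, 0 < K & forall m n p k : nat, 0 < m ->
    K * m ^ (2 * l.+1 + 2) <= n -> n <= p -> 4 * p <= n ^ 2 ->
    DSFG_ok R n p k -> m ^ l <= K * k.
Proof.
move=> l0; set L := l.+1.
have L2 : L.+2 <= 2 * L by rewrite /L; lia.
have LL : 2 + (L + L) = 2 * L + 2 by lia.
have LL' : 2 * L + 2 = L.+2 + L by lia.
have ar1 x y z : x * (y * (2 * z)) = z * (2 * (x * y)) by lia.
have ar2 x y z t : x * (y * (z * (2 * t))) = 2 * (y * z) * x * t by lia.
have ar3 A B C : A <= C -> 2 < B -> 0 < A -> 2 * A < B * C by nia.
have ar4 c y x z : 8 * c * L * z * (x * y) = 2 * (2 * (c * x) * (L * (z * y) + L * (z * y))) by lia.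
have ar5 n0 n w D : n0 = 2 * w * (1 + L * D) -> 2 * n0 <= n ->
    w + w + l.+1 * w * D * 2 + (n - n0) = n by rewrite -/L; lia.
have ar6 n0 n p : 2 * n0 <= n -> 4 * p <= n ^ 2 -> p <= (n - n0) ^ 2 by nia.
(* There are [c1 * m ^ L.+2] points and [c2 * m ^ (2 * L + 2)] lines. The summands of [K] serve the
   vertex count, the line count and the final bound. *)
pose c1 := L ^ L.+1 * (L * (4 * L ^ 2) ^ L.+2).
pose c2 := L * (4 * L ^ 2) ^ (2 * L + 2).
pose K := 8 * c1 * L * 2 ^ L + c2 + 2 * L ^ L.+2.
have K_gt0 : 0 < K by rewrite addn_gt0 [0 < 2 * _]muln_gt0 expn_gt0 orbT.
exists K => // m n p k m0 Kn np pn ok.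
have [b Bb] : exists b, b.+1 = 4 * L ^ 2 * m.
  by exists (4 * L ^ 2 * m).-1; rewrite prednK // muln_gt0 m0.
have [d Dd] : exists d, d.+1 = (2 * m) ^ L.
  by exists ((2 * m) ^ L).-1; rewrite prednK // expn_gt0 muln_gt0 m0.
pose Mo := L * b.+1 ^ 2 * b.+1 ^ L.
have cQ : #|line L b| = Mo * b.+1 ^ L by rewrite card_line.
have cW : #|point l L b| = L ^ L.+1 * Mo by rewrite card_point.
(* Half of the lines may meet heavy nodes, and the other half must be light. *)
have [M2 HM2] : exists M2, Mo = 2 * M2.
  exists (2 * L ^ 2 * m * b.+1 * L * b.+1 ^ L).
  by rewrite /Mo -mulnn {1}Bb; lia.
(* After division by [D] this reads [2 * m^(l L) <= (2 m)^(L l)]. *)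
have r_small : 2 * (d.+1 * (m ^ l) ^ l.+1) <= d.+1 ^ l.+1.
  rewrite [X in _ <= X]expnS mulnCA leq_mul2l /=.
  rewrite Dd -!expnM expnMn [L * l]mulnC leq_mul2r.
  by rewrite -[X in X <= _](expn1 2) leq_exp2l ?muln_gt0 ?l0 ?orbT.
have hQ : M2 * b.+1 ^ L + M2 * b.+1 ^ L <= #|line L b|.
  by rewrite cQ HM2 addnn -mul2n mulnA.
have M0 : 0 < M2.
  have : 0 < Mo by rewrite !muln_gt0 !expn_gt0.
  by rewrite HM2; case: M2 {HM2 hQ}.
(* The factor [4 L^2] in [B] gives [B^L = 2^L L^(2L) D], so that [2 L^(L+2) < 2^L L^(2L)] suffices;
   it holds as [L >= 2]. *)
have h_large : l.+1 * #|point l L b| * d.+1 < M2 * b.+1 ^ L.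
  have -> : b.+1 ^ L = 2 ^ L * L ^ (2 * L) * d.+1.
    rewrite Bb Dd -[4]/(2 * 2) expnMn (expnMn _ (L ^ 2)) -expnM.
    by rewrite !expnMn; lia.
  rewrite mulnA ltn_mul2r /= cW HM2.
  have -> : l.+1 * (L ^ L.+1 * (2 * M2)) = M2 * (2 * L ^ L.+2).
    by rewrite ar1 -expnS.
  rewrite ltn_mul2l M0 /=.
  have e1 : L ^ L.+2 <= L ^ (2 * L) by rewrite leq_exp2l.
  have e2 : 2 < 2 ^ L by rewrite -[X in X < _](expn1 2) ltn_exp2l.
  by apply: ar3; rewrite ?expn_gt0.
have degg : forall (j : 'I_l.+1) (w : point l L b),
    #|[set q | line_pt l q j == w]| <= b.+1 ^ L by move=> j w; apply: card_lines_through.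
have [a ha] := exists_labelling degg r_small hQ h_large.
(* [n0] counts the vertices that are not idle. At least [n / 2] remain idle, which gives at least
   [n ^ 2 / 4 >= p] padding pairs. *)
pose n0 := 2 * #|point l L b| * (1 + L * d.+1).
have m_pow : m ^ (2 * L + 2) = m ^ L.+2 * m ^ L by rewrite LL' expnD.
have eM : Mo = L * (4 * L ^ 2) ^ L.+2 * m ^ L.+2.
  by rewrite /Mo -mulnA -expnD add2n Bb expnMn mulnA.
have n0n : 2 * n0 <= n.
  apply: leq_trans Kn; rewrite -/L.
  have -> : n0 = 2 * (c1 * m ^ L.+2) * (1 + L * (2 ^ L * m ^ L)).
    by rewrite /n0 cW eM Dd (expnMn 2 m L) /c1 !mulnA.
  have e1 : 1 <= L * (2 ^ L * m ^ L) by rewrite !muln_gt0 !expn_gt0 m0.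
  rewrite m_pow /K; set x := m ^ L.+2; set y := m ^ L; set z := 2 ^ L; rewrite -/y -/z in e1.
  apply: (@leq_trans (8 * c1 * L * z * (x * y))); last by rewrite leq_mul2r -addnA leq_addr orbT.
  by rewrite ar4 leq_mul2l leq_mul2l leq_add2r e1 !orbT.
have Qn : #|line L b| <= n.
  have -> : #|line L b| = c2 * m ^ (2 * L + 2).
    rewrite cQ /Mo -2![in LHS]mulnA -(expnD _ L) -expnD LL Bb expnMn.
    by rewrite mulnA.
  by apply: leq_trans Kn; rewrite leq_mul2r /K addnAC leq_addl orbT.
have cV : #|vertex l d (n - n0) (point l L b)| = n.
  by rewrite card_vertex; apply: ar5.
have Qp : #|line L b| <= p <= #|line L b| + (n - n0) ^ 2.
  rewrite (leq_trans Qn np) /=; apply: leq_trans (leq_addl _ _).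
  exact: ar6.
have L0 : 0 < L by [].
have := gap_instance l0 (@line_pt_unique l L b L0) ha cV Qp ok.
move=> /ltnW; rewrite cW HM2.
have -> : k * (l.+1 * (L ^ L.+1 * (2 * M2))) = 2 * L ^ L.+2 * k * M2.
  by rewrite ar2 -expnS.
rewrite leq_mul2r eqn0Ngt M0 /= => /leq_trans; apply.
by rewrite leq_mul2r /K leq_addl orbT.
Qed.

(** * Bridge-free systems *)

(** With unit weights on all edges, [k = 0] would force an empty purchase, which cannot serve the
    demand [st]. *)
Lemma DSFG_ok_gt0 (R : realType) (n p k : nat) :
  1 < n -> 0 < p <= n ^ 2 -> DSFG_ok R n p k -> 0 < k.
Proof.
move=> n1 /andP[p0 pn2] ok; rewrite lt0n; apply/negP => /eqP k0; subst k.
pose st : 'I_n * 'I_n := (Ordinal (ltnW n1), Ordinal n1).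
have [P1 sP1 cP1] : exists2 P1 : {set 'I_n * 'I_n}, P1 \subset [set~ st] & #|P1| = p.-1.
  apply: exists_subset_card; rewrite cardsC1 card_prod card_ord mulnn.
  by rewrite -ltnS !prednK ?expn_gt0 ?(ltnW n1).
have {}ok : DSFG_ok R #|'I_n| p 0 by rewrite card_ord.
have [||||y [fy cy]] := @DSFG_ok_finType R _ _ _ ok (fun _ _ => true)
    (fun _ _ => 1%R) (st |: P1) _ _ (fun _ _ => 1%R).
- by move=> *; apply: ler01.
- rewrite cardsU1 cP1; have -> : st \notin P1.
    by apply/negP => /(subsetP sP1); rewrite !inE eqxx.
  by rewrite add1n prednK.
- by move=> *; apply: ler01.
- move=> s t _; apply: (@walks_flow R _ unit _ _ _ _ 1 (fun _ i => if i == 0 then s else t)) => //.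
  - by rewrite card_unit.
  - by move=> u v _; rewrite card_unit mul1r (ler_nat _ _ 1);
       apply: leq_trans (max_card _) _; rewrite card_prod card_unit card_ord.
rewrite mul0r in cy.
have y0 u v : y u v = false.
  apply/negP => yuv; move: cy; apply/negP; rewrite -ltNge /cost_on.
  rewrite (bigD1 u) //= (bigD1 v) //= yuv mul1r -addrA ltr_pwDl ?ltr01 // addr_ge0 //.
    by apply: sumr_ge0 => *; rewrite mul1r ler0n.
  by apply: sumr_ge0 => *; apply: sumr_ge0 => *; rewrite mul1r ler0n.
have := flow_closed (A := [set st.1]) (fy st.1 st.2 _); rewrite !inE !eqxx /=.
move=> /(_ isT isT); rewrite -val_eqE /= => h; suff: false by [].
by apply: h => u v _ _; rewrite y0.
Qed.

Section BridgeFree.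

Variables (n : nat) (Pi : seq (seq 'I_n)).

Lemma card_prec (pi : seq 'I_n) :
  uniq pi -> 'C(size pi, 2) <= #|[set xy | prec pi xy.1 xy.2]|.
Proof.
elim: pi => [|z pi IH] //= /andP[zpi upi].
rewrite binS bin1.
have cz : #|[set (z, y) | y in pi]| = size pi.
  by rewrite card_imset ?(card_uniqP upi) // => y y' [].
rewrite -[X in _ + X <= _]cz.
apply: leq_trans (leq_add (IH upi) (leqnn _)) _.
rewrite -(leq_add2r #|[set xy | prec pi xy.1 xy.2] :&: [set (z, y) | y in pi]|) -cardsUI.
rewrite (_ : _ :&: _ = set0) ?cards0 ?addn0; last first.
  apply/setP => -[x y]; rewrite !inE /prec /=; apply/negP => /andP[/and3P[xpi _ _]].
  by case/imsetP => y' _ [xz _]; rewrite -xz xpi in zpi.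
apply: subset_leq_card; apply/subsetP => -[x y]; rewrite !inE /prec /= !inE.
case/orP => [/and3P[xpi ypi lt]|/imsetP[y' ypi [-> ->]]].
  rewrite xpi ypi !orbT /=; case: eqP => [zx|_]; first by rewrite zx xpi in zpi.
  by case: eqP => [zy|_]; first by rewrite zy ypi in zpi.
rewrite !eqxx ypi orbT /=; case: eqP => [zy|//].
by rewrite zy ypi in zpi.
Qed.

Hypotheses (Pi_uniq : path_system Pi) (Pi_free : bridge_free Pi).

(** Two paths that both place [x] before [y] form a 2-bridge, so each ordered pair is counted at
    most once. *)
Lemma bridge_free_pairs :
  \sum_(i < size Pi) 'C(size (nth [::] Pi i), 2) <= n ^ 2.
Proof.
apply: (@leq_trans (\sum_(i < size Pi)
    \sum_(xy : 'I_n * 'I_n) prec (nth [::] Pi i) xy.1 xy.2)).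
  apply: leq_sum => i _; apply: leq_trans (card_prec _) _.
    by apply: (allP Pi_uniq); apply: mem_nth.
  rewrite -sum1dep_card big_mkcond /=; apply: leq_sum => xy _.
  by case: prec.
rewrite exchange_big /=.
have -> : n ^ 2 = \sum_(xy : 'I_n * 'I_n) 1.
  by rewrite sum1_card card_prod card_ord mulnn.
apply: leq_sum => -[x y] _ /=.
have -> : \sum_(i < size Pi) prec (nth [::] Pi i) x y
    = #|[set i : 'I_(size Pi) | prec (nth [::] Pi i) x y]|.
  by rewrite -sum1dep_card [RHS]big_mkcond /=; apply: eq_bigr => i _; case: prec.
apply/card_le1_eqP => i j; rewrite !inE => pi pj; apply/eqP/negPn/negP => ij.
have xy : x != y by apply/eqP => e; move: pi; rewrite /prec e ltnn !andbF.
apply: (Pi_free (b := 2)).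
exists (fun t => if t == 0 then x else y), (fun t => if t == 0 then i : nat else j).
split => //; split; last split; last split; last split => //.
- move=> [|[|a]] [|[|b]] //= _ _ e; first by rewrite e eqxx in xy.
  by rewrite e eqxx in xy.
- move=> [|[|a]] [|[|b]] //= _ _ e; first by case/eqP: ij; apply: val_inj.
  by case/eqP: ij; apply: val_inj.
- by move=> t _; case: ifP.
- by case.
Qed.

Local Open Scope ring_scope.

(** A path size [s] is bounded linearly in ['C(s, 2)], using [(t - (s - 1))^2 >= 0]. With
    [t = n / sqrt p] the three sums are at most [n sqrt p], [n sqrt p / 2] and [n sqrt p]. *)
Lemma bridge_free_size (R : realType) : (0 < n)%N -> (0 < size Pi <= n ^ 2)%N ->
  (ps_size Pi)%:R <= 5 / 2 * n%:R * Num.sqrt ((size Pi)%:R : R).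
Proof.
move=> n0 /andP[p0 pn2]; set p := size Pi; set r := Num.sqrt _.
have rr : r * r = p%:R by rewrite -expr2 sqr_sqrtr.
have r0 : 0 < r by rewrite sqrtr_gt0 ltr0n.
have n0R : 0 < n%:R :> R by rewrite ltr0n.
have rn : r <= n%:R.
  by rewrite -(ler_sqr (x := r)) ?nnegrE ?ler0n ?(ltW r0) // expr2 rr -natrX ler_nat.
pose t := n%:R / r; have t0 : 0 < t by rewrite divr_gt0.
have step s : s%:R <= 1 + t / 2 + 'C(s, 2)%:R / t :> R.
  have [->|s0] := posnP s; first by rewrite bin0n mul0r; lra.
  have b2 : 2 * 'C(s, 2)%:R = s%:R * (s%:R - 1) :> R.
    have -> : s%:R - 1 = s.-1%:R :> R by rewrite -[in LHS](prednK s0) -natr1 addrK.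
    by rewrite -!natrM -mul_bin_diag bin1.
  rewrite -(ler_pM2r t0) mulrDl divfK ?gt_eqF //.
  have := sqr_ge0 (t - (s%:R - 1)); have : 1 <= s%:R :> R by rewrite ler1n.
  by nra.
have tot : (ps_size Pi)%:R <= \sum_(i < p) (1 + t / 2 + 'C(size (nth [::] Pi i), 2)%:R / t).
  rewrite /ps_size sumnE big_map (big_nth [::]) big_mkord natr_sum.
  by apply: ler_sum => i _; apply: step.
apply: le_trans tot _; rewrite big_split /= -mulr_suml -natr_sum.
rewrite sumr_const card_ord -[X in X + _ <= _]mulr_natl -rr.
have : (\sum_(i < p) 'C(size (nth [::] Pi i), 2))%:R / t <= n%:R * r.
  rewrite ler_pdivrMr // /t mulrA mulrAC mulfK ?gt_eqF //.
  by rewrite -expr2 -natrX ler_nat bridge_free_pairs.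
have -> : r * r * (1 + t / 2) = r * r + n%:R * r / 2.
  by rewrite /t; field; rewrite gt_eqF.
by nra.
Qed.

End BridgeFree.

(** * Asymptotics *)

From mathcomp Require Import all_classical all_reals all_analysis.
Local Open Scope ring_scope.

Lemma powR_nat_eventually_ge (R : realType) (C kappa : R) : 0 <= C -> 0 < kappa ->
  exists N : nat, forall n, (N <= n)%N -> C <= n%:R `^ kappa.
Proof.
move=> C0 k0; exists (Num.truncn (C `^ kappa^-1)).+1 => n Nn.
have -> : C = (C `^ kappa^-1) `^ kappa.
  by rewrite -powRrM mulVf ?gt_eqF // powRr1.
rewrite ge0_ler_powR ?nnegrE ?powR_ge0 ?ler0n ?(ltW k0) //.
by apply: le_trans (ltW (truncnS_gt _)) _; rewrite ler_nat.
Qed.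

(** For the largest [m] with [K * m ^ e <= n], the gap [m ^ i.+1] is of order [n ^ alpha] with
    [alpha = i.+1 / e = 1/2 - 1/(i+3)]. Giving up [kappa] in the exponent absorbs the constant
    [C]. *)
Lemma DSFG_eventually_ge (R : realType) (i : nat) :
  exists N : nat, forall n, (N <= n)%N -> forall p k, (n <= p)%N -> (4 * p <= n ^ 2)%N ->
    DSFG_ok R n p k -> n%:R `^ (1 / 2 - i.+1%:R^-1) <= k%:R :> R.
Proof.
have [K K0 gap] := @DSFG_power_gap R i.+1 isT.
pose e := (2 * i.+2 + 2)%N; rewrite -/e in gap.
have e6 : e = (2 * i + 6)%N by rewrite /e; lia.
have e0 : (0 < e)%N by rewrite e6 addn_gt0 orbT.
clearbody e.
pose C : R := K%:R ^+ 2 * 2 ^+ i.+1.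
have K1 : 1 <= K%:R :> R by rewrite ler1n.
have C0 : 0 < C by rewrite mulr_gt0 ?exprn_gt0 // ltr0n.
pose kappa : R := i.+1%:R^-1 - i.+3%:R^-1.
have k0 : 0 < kappa by rewrite subr_gt0 ltf_pV2 ?posrE ?ltr0n // ltr_nat.
have [N hN] := powR_nat_eventually_ge (ltW C0) k0.
exists (maxn N K) => n; rewrite geq_max => /andP[Nn Kn] p k np pn ok.
have n0 : (0 < n)%N by apply: leq_trans Kn.
have n0R : n%:R != 0 :> R by rewrite pnatr_eq0 -lt0n.
have [m [m0 Km nK]] : exists m, [/\ (0 < m)%N, (K * m ^ e <= n)%N & (n <= K * (2 * m) ^ e)%N].
  have ex : exists m, (K * m ^ e <= n)%N by exists 1%N; rewrite exp1n muln1.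
  have ub m : (K * m ^ e <= n)%N -> (m <= n)%N.
    apply: leq_trans; apply: leq_trans (leq_pmull _ K0).
    by case: m => // m; rewrite -[X in (X <= _)%N]expn1 leq_pexp2l.
  case: (ex_maxnP ex ub) => m hm max.
  have m0 : (0 < m)%N by apply: max; rewrite exp1n muln1.
  exists m; split => //; rewrite leqNgt; apply/negP => lt.
  by have := max (2 * m)%N (ltnW lt); lia.
have mk := gap m n p k m0 Km np pn ok.
pose alpha : R := 1 / 2 - i.+3%:R^-1.
have eal : e%:R * alpha = i.+1%:R.
  rewrite e6 /alpha -[i.+3]addn3 -[i.+1]addn1 !natrD; field.
  by have := ler0n R i; lra.
have a0 : 0 <= alpha.
  by rewrite -(pmulr_rge0 (x := e%:R)) ?eal ?ler0n // ltr0n.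
have a1 : alpha <= 1.
  have : 0 <= i.+3%:R^-1 :> R by rewrite invr_ge0.
  by rewrite /alpha; move: (i.+3%:R^-1) => x x0; lra.
(* One factor [K] of [C] bounds [K ^ alpha], the other comes from [mk]; the power of 2 is
   [(2 ^ e) ^ alpha]. *)
have up : n%:R `^ alpha <= C * k%:R.
  apply: (@le_trans _ _ ((K%:R * (2 * m%:R) ^+ e) `^ alpha)).
    rewrite ge0_ler_powR ?nnegrE ?ler0n //.
    have -> : K%:R * (2 * m%:R) ^+ e = (K * (2 * m) ^ e)%:R :> R.
      by rewrite natrM natrX natrM.
    by rewrite ler_nat.
  rewrite powRM ?ler0n ?exprn_ge0 ?mulr_ge0 // -powR_mulrn ?mulr_ge0 //.
  rewrite -powRrM eal powR_mulrn ?mulr_ge0 // exprMn /C expr2.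
  rewrite -!mulrA; apply: ler_pM; rewrite ?powR_ge0 ?mulr_ge0 ?exprn_ge0 //.
    by rewrite ler1_powR.
  rewrite mulrCA ler_wpM2l ?exprn_ge0 //.
  by rewrite -natrX -natrM ler_nat.
rewrite -(ler_pM2l C0); apply: le_trans up.
apply: (@le_trans _ _ (n%:R `^ kappa * n%:R `^ (1 / 2 - i.+1%:R^-1))).
  by rewrite ler_wpM2r ?powR_ge0 // hN.
rewrite -powRD ?n0R ?implybT //.
by rewrite le_eqVlt; apply/orP; left; apply/eqP; congr (_ `^ _);
   rewrite /kappa /alpha; move: (i.+3%:R^-1) (i.+1%:R^-1) => x x'; lra.
Qed.

Lemma diagonal_index (P : nat -> nat -> Prop) :
  (forall i, exists N : nat, forall n, (N <= n)%N -> P i n) ->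
  exists f : nat -> nat,
    (forall i, exists N : nat, forall n, (N <= n)%N -> (i <= f n)%N) /\
    exists N : nat, forall n, (N <= n)%N -> P (f n) n.
Proof.
(* [f n] is the largest index up to [n] whose threshold has been passed; from [N 0] on such an index
   exists, so the maximum is attained. *)
move=> /choice[N hN]; exists (fun n => (\max_(i < n.+1 | N i <= n) i)%N); split.
  move=> i; exists (maxn i (N i)) => n; rewrite geq_max => /andP[inn Nn].
  exact: (@leq_bigmax_cond _ (fun j : 'I_n.+1 => (N j <= n)%N) (fun j => j : nat)
    (Ordinal (inn : (i < n.+1)%N)) Nn).
exists (N 0%N) => n Nn.
have [|j hj ->] := @eq_bigmax_cond _ (fun j : 'I_n.+1 => (N j <= n)%N) (fun j => j : nat).
  by apply/card_gt0P; exists ord0.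
exact: hN.
Qed.

Local Open Scope classical_set_scope.
Local Open Scope ring_scope.

Theorem theorem5p17 (R : realType) :
  exists eps : nat -> R, eps m @[m --> \oo] --> 0%R /\
  (exists (c : R) (N : nat), 0 < c /\
     forall (n p k : nat), (N <= n)%N -> (1 <= p)%N ->
       p%:R <= n%:R `^ (2 - eps n) ->
       DSFG_ok R n p k ->
       forall Pi : seq (seq 'I_n),
         path_system Pi -> size Pi = p -> bridge_free Pi ->
         c * (ps_size Pi)%:R <= n%:R `^ (3 / 2) * k%:R) /\
  (exists (delta : nat -> R) (c : R) (N : nat),
     delta m @[m --> \oo] --> 0%R /\ 0 < c /\
     forall (n k : nat), (N <= n)%N ->
       DSFG_ok R n (Num.truncn (n%:R `^ (2 - eps n))) k ->
       c * n%:R `^ (1 / 2 - delta n) <= k%:R).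
Proof.
(* The first clause makes [p <= n ^ (2 - eps n)] imply [4 * p <= n ^ 2]. *)
pose P i n := 4 <= n%:R `^ (2 / i.+1%:R) :> R /\
  forall p k, (n <= p)%N -> (4 * p <= n ^ 2)%N ->
    DSFG_ok R n p k -> n%:R `^ (1 / 2 - i.+1%:R^-1) <= k%:R :> R.
have [|f [f_infty [N0 hN0]]] := @diagonal_index P.
  move=> i; have [N1 h1] := @DSFG_eventually_ge R i.
  have [||N2 h2] := @powR_nat_eventually_ge R 4 (2 / i.+1%:R); [by []|by rewrite divr_gt0|].
  exists (maxn N1 N2) => n; rewrite geq_max => /andP[n1 n2].
  by split; [apply: h2|apply: h1].
(* The numerator 2 makes [eps n / 2], the saving in [sqrt p], equal to the exponent lost in the
   gap. *)
pose eps n : R := 2 / (f n).+1%:R.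
have eps_cvg : eps m @[m --> \oo] --> 0%R.
  apply/cvgr0Pnorm_lt => e e0.
  have [N hN] := f_infty (Num.truncn (2 / e)).
  exists N => // n /= /hN fn; rewrite ger0_norm ?divr_ge0 //.
  rewrite /eps ltr_pdivrMr ?ltr0n // -ltr_pdivrMl // mulrC.
  by apply: lt_le_trans (truncnS_gt _) _; rewrite ler_nat.
have pow n : (0 < n)%N -> forall a b : R, n%:R `^ a * n%:R `^ b = n%:R `^ (a + b).
  by move=> n0 a b; rewrite powRD // pnatr_eq0 -lt0n n0 implybT.
have eps_pow n : (maxn N0 2 <= n)%N -> n%:R `^ (2 - eps n) <= (n ^ 2)%:R / 4.
  rewrite geq_max => /andP[/hN0[h4 _] n2]; have n0 : (0 < n)%N by apply: leq_trans n2.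
  rewrite ler_pdivlMr //; apply: (@le_trans _ _ (n%:R `^ (2 - eps n) * n%:R `^ eps n)).
    by rewrite ler_wpM2l ?powR_ge0.
  by rewrite pow // subrK natrX -powR_mulrn.
have partA : forall (n p k : nat), (maxn N0 2 <= n)%N -> (1 <= p)%N ->
    p%:R <= n%:R `^ (2 - eps n) -> DSFG_ok R n p k ->
    forall Pi : seq (seq 'I_n), path_system Pi -> size Pi = p -> bridge_free Pi ->
      2 / 5 * (ps_size Pi)%:R <= n%:R `^ (3 / 2) * k%:R :> R.
  move=> n p k Nn p1 pn ok Pi uPi sPi fPi.
  have := Nn; rewrite geq_max => /andP[nN0 n2].
  have n0 : (0 < n)%N by apply: leq_trans n2.
  have p4 : (4 * p <= n ^ 2)%N.
    have := le_trans pn (eps_pow n Nn); rewrite ler_pdivlMr // mulrC -natrM.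
    by rewrite ler_nat.
  have pn2 : (0 < p <= n ^ 2)%N by rewrite p1 /=; lia.
  have k1 : 1 <= k%:R :> R by rewrite ler1n (DSFG_ok_gt0 n2 pn2 ok).
  have := @bridge_free_size n Pi uPi fPi R n0; rewrite sPi => /(_ pn2) hs.
  suff : n%:R * Num.sqrt (p%:R : R) <= n%:R `^ (3 / 2) * k%:R by lra.
  have -> : 3 / 2 = 1 + 1 / 2 :> R by lra.
  rewrite -pow // powRr1 // -mulrA ler_wpM2l //.
  (* For [p <= n] the bound [1 <= k] suffices; otherwise [sqrt p <= n ^ (1 - eps n / 2)] is matched
     by the gap. *)
  have [lepn|ltnp] := leqP p n.
    apply: (@le_trans _ _ (n%:R `^ (1 / 2))); last by rewrite ler_peMr ?powR_ge0.
    by rewrite mul1r powR12_sqrt // ler_sqrt ?ler_nat.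
  have [_ hk] := hN0 n nN0.
  apply: (@le_trans _ _ (n%:R `^ (1 / 2) * n%:R `^ (1 / 2 - (f n).+1%:R^-1))); last first.
    by rewrite ler_wpM2l ?powR_ge0 // (hk p k) // ltnW.
  rewrite pow // -powR12_sqrt //.
  have -> : 1 / 2 + (1 / 2 - (f n).+1%:R^-1) = (2 - eps n) * 2^-1 :> R.
    by rewrite /eps; move: ((f n).+1%:R^-1) => x; lra.
  by rewrite powRrM ge0_ler_powR ?nnegrE ?powR_ge0.
exists eps; split => //; split; first by exists (2 / 5), (maxn N0 2); split.
(* The first bound is applied to one-node paths, whose size is their number. Truncation at most
   halves [z], which turns [2 / 5] into [1 / 5]. *)
exists eps, (1 / 5), (maxn (maxn N0 2) 4); split => //; split => // n k.
rewrite geq_max => /andP[Nn n4] ok.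
have n2 : (2 <= n)%N by apply: leq_trans n4.
have n0 : (0 < n)%N by apply: leq_trans n2.
set z := n%:R `^ (2 - eps n) in ok.
have z1 : 1 <= z.
  rewrite -(powRr0 n%:R); apply: ler_powR; first by rewrite ler1n.
  by rewrite subr_ge0 ler_pdivrMr ?ltr0n // ler_peMr // ler1n.
have p1 : (1 <= Num.truncn z)%N by rewrite truncn_gt0.
have zp : (Num.truncn z)%:R <= z by rewrite truncn_le (le_trans ler01).
have pz : z <= 2 * (Num.truncn z)%:R.
  have := truncnS_gt z; rewrite -natr1.
  have : 1 <= (Num.truncn z)%:R :> R by rewrite ler1n.
  by lra.
have := partA n _ k Nn p1 zp ok (nseq (Num.truncn z) [:: Ordinal n0]).
have -> : ps_size (nseq (Num.truncn z) [:: Ordinal n0]) = Num.truncn z.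
  by rewrite /ps_size map_nseq sumn_nseq mul1n.
rewrite size_nseq => main0.
have ups : path_system (nseq (Num.truncn z) [:: Ordinal n0]).
  by apply/allP => s /nseqP[-> _].
have bf : bridge_free (nseq (Num.truncn z) [:: Ordinal n0]).
  move=> b [v [q [b0 [_ [_ [hq [_]]]]]]]; rewrite nth_nseq; case: ifP => _ //.
  by rewrite /prec !inE => /and3P[/eqP-> /eqP->]; rewrite ltnn.
have {main0} main := main0 ups erefl bf.
have n32 : 0 < n%:R `^ (3 / 2) :> R by rewrite powR_gt0 // ltr0n.
rewrite -(ler_pM2l n32) mulrCA pow //.
have -> : 3 / 2 + (1 / 2 - eps n) = 2 - eps n by move: (eps n) => x; lra.
by rewrite -/z; apply: le_trans main; lra.
Qed.
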